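(* Let $S_X\in L_1(\mathbb R)$ be the (nonzero) power spectral density of a zero-mean real wide-sense stationary process $X(\cdot)$; assume that $S_X$ is unimodal (symmetric and non-increasing for $f>0$) and that $X(\cdot)$ is bandlimited, with Nyquist rate $f_{\mathrm{Nyq}}=2\sup\{|f|:f\in\mathrm{supp}\,S_X\}<\infty$. Fix a bitrate $R>0$ and a constant $c_0>0$. If $f_s^\star$ minimizes $$D_{\mathrm{PCM}}(f_s,R)=\mathrm{mmse}^\star(f_s)+\int_{-f_s/2}^{f_s/2}\frac{S_X(f)}{1+f_s\,2^{2R/f_s}\,S_X(f)/c_0}\,df$$ over sampling rates $0<f_s\le R$, then $f_s^\star\le f_{\mathrm{Nyq}}$.
   Context: $\mathrm{mmse}^\star(f_s)=\sigma_X^2-\sup\{\int_FS_X(f)\,df:\ F\subset\mathbb R\text{ measurable with Lebesgue measure at most }f_s\}$, where $\sigma_X^2=\int S_X(f)\,df$. $D_{\mathrm{PCM}}(f_s,R)$ is the distortion of pulse-code modulation at sampling rate $f_s$ in which each sample is quantized with $q=R/f_s$ bits; the requirement $f_s\le R$ means at least one bit per sample. The constant $c_0$ does not depend on $f_s$. *)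

(* Defs.v *)
(* MathComp-Analysis *)
From HB Require Import structures.
From mathcomp Require Export all_boot all_order all_algebra.
From mathcomp Require Export all_classical all_reals all_analysis.

Set Implicit Arguments.
Unset Strict Implicit.
Unset Printing Implicit Defensive.

Import Order.TTheory GRing.Theory Num.Theory.
Import numFieldNormedType.Exports.

Local Open Scope classical_set_scope.
Local Open Scope ring_scope.

Record zero_mean_wss (d : measure_display) (Omega : measurableType d)
    (R : realType) (P : probability Omega R) (X : R -> {RV P >-> R}) : Prop := {
  wss_square_integrable : forall t, (X t : Omega -> R) \in Lfun P 2%:E ;
  wss_mean0 : forall t, ('E_P[X t] = 0)%E ;
  wss_stationary : forall s t tau,
    covariance P (X (s + tau)) (X s) = covariance P (X (t + tau)) (X t) }.

(* [S] is the Fourier transform of the autocovariance function, written in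
   inverted form: Cov(X_(t+tau), X_t) = \int S(f) e^(2 i pi f tau) df, split
   into its real and imaginary parts (the process is real-valued). *)
Record psd (d : measure_display) (Omega : measurableType d)
    (R : realType) (P : probability Omega R) (X : R -> {RV P >-> R})
    (S : R -> R) : Prop := {
  psd_ge0 : forall f, 0 <= S f ;
  psd_integrable : lebesgue_measure.-integrable setT (EFin \o S) ;
  psd_re : forall t tau, covariance P (X (t + tau)) (X t) =
    (\int[lebesgue_measure]_f (S f * cos (2 * pi * f * tau)))%:E ;
  psd_im : forall tau,
    \int[lebesgue_measure]_f (S f * sin (2 * pi * f * tau)) = 0 }.

Definition unimodal (R : realType) (S : R -> R) : Prop :=
  (forall f, S (- f) = S f) /\
  (forall f g, 0 < f -> f <= g -> S g <= S f).

Definition supp (R : realType) (S : R -> R) : set R :=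
  closure [set f | S f != 0].

(* Extended-real valued, so that a process is bandlimited exactly when its
   Nyquist rate is < +oo. *)
Definition nyquist_rate (R : realType) (S : R -> R) : \bar R :=
  (2%:E * ereal_sup [set `|f|%:E | f in supp S])%E.

Definition variance_of_psd (R : realType) (S : R -> R) : R :=
  \int[lebesgue_measure]_f S f.

Definition mmse_star (R : realType) (S : R -> R) (fs : R) : R :=
  variance_of_psd S -
  sup [set \int[lebesgue_measure]_(f in F) S f
      | F in [set F : set R | measurable F /\
                              (lebesgue_measure F <= fs%:E)%E]].

Definition D_PCM (R : realType) (S : R -> R) (c0 fs rate : R) : R :=
  mmse_star S fs +
  \int[lebesgue_measure]_(f in `[- (fs / 2), fs / 2])
     (S f / (1 + fs * (2 `^ (2 * rate / fs)) * S f / c0)).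

(* Main.v *)
(* Above the Nyquist rate the term mmse_star vanishes and the quantization
   integral runs over the whole support of S, so fs enters only through
   fs 2^(2 rate / fs). This factor strictly decreases on fs <= rate, hence the
   distortion strictly increases there, and the Nyquist rate itself is strictly
   better than any larger admissible sampling rate. *)
Require Import Defs.
From mathcomp Require Import measurable_realfun ring lra.
Import Order.TTheory GRing.Theory Num.Theory.
Import numFieldNormedType.Exports.
Local Open Scope classical_set_scope.
Local Open Scope ring_scope.

(** The difference [g - f] is nonnegative with integral at most 0, so its integral is 0 and it
    vanishes almost everywhere. This is the source of strictness when two distortions are
    compared. *)
Lemma Rintegral_ge_ae_eq {d : measure_display} {T : measurableType d}
    {R : realType} {mu : {measure set T -> \bar R}} {f g : T -> R} :
  mu.-integrable setT (EFin \o f) -> mu.-integrable setT (EFin \o g) ->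
  (forall x, f x <= g x) -> \int[mu]_x g x <= \int[mu]_x f x ->
  {ae mu, forall x, f x = g x}.
Proof.
move=> intf intg fg gf.
have intB : mu.-integrable setT (EFin \o (fun x => g x - f x)).
  by have := integrableB measurableT intg intf; apply: eq_integrable.
have int0 : (\int[mu]_x `|(g x - f x)%:E| = 0)%E.
  rewrite (eq_integral (EFin \o (fun x => g x - f x))); last first.
    by move=> x _ /=; rewrite ger0_norm// subr_ge0.
  rewrite -[LHS]fineK; last exact: (integrable_fin_num measurableT intB).
  apply/eqP; rewrite eqe eq_le; apply/andP; split.
    have := @RintegralB _ _ _ mu setT g f measurableT intg intf.
    by rewrite /Rintegral => ->; rewrite subr_le0.
  by apply: Rintegral_ge0 => x _; rewrite subr_ge0.
move: int0 => /(ae_eq_integral_abs mu measurableT (measurable_int _ intB)).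
by apply: filterS => x /(_ I) /= [] /eqP; rewrite subr_eq0 => /eqP ->.
Qed.

Lemma Rintegral_support {d : measure_display} {T : measurableType d}
    {R : realType} {mu : {measure set T -> \bar R}} {D : set T} {f : T -> R} :
  (forall x, f x != 0 -> D x) -> \int[mu]_(x in D) f x = \int[mu]_x f x.
Proof.
move=> fD; rewrite Rintegral_mkcond; congr (Rintegral _ _ _); apply/funext => x.
rewrite patchE; case: ifPn => // /negP; rewrite inE => nDx.
by apply/esym/eqP; apply/negPn/negP => /fD.
Qed.

(** Inverting [e^(-1/2) >= 1 - 1/2] gives [e^(1/2) <= 2]. The bound serves to place the turning
    point [2 rate ln 2] no lower than [rate]. *)
Lemma ln2_ge_half (R : realType) : 2^-1 <= ln 2 :> R.
Proof.
rewrite -ler_expR lnK ?posrE//.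
have := expR_ge1Dx (- 2^-1 : R); rewrite expRN => h.
rewrite -[leRHS]invrK -[leLHS]invrK lef_pV2 ?posrE ?invr_gt0 ?expR_gt0//.
by apply: le_trans h; lra.
Qed.

(* The function x |-> x 2^(2 rate / x) decreases up to x = 2 rate ln 2, which
   exceeds rate. *)
Lemma mul_pow2_div_decreasing {R : realType} {rate x y : R} :
  0 < x -> x < y -> y <= rate ->
  y * 2 `^ (2 * rate / y) < x * 2 `^ (2 * rate / x).
Proof.
move=> x0 xy yr; have y0 : 0 < y by exact: lt_trans xy.
rewrite /powR pnatr_eq0/=.
set a := 2 * rate / y * ln 2; set b := 2 * rate / x * ln 2.
have -> : b = (b - a) + a by ring.
rewrite expRD mulrA ltr_pM2r ?expR_gt0//.
(* The gap [b - a] is [y / x - 1] times two factors that are at least 1: [rate / y], because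
   [y <= rate], and [2 * ln 2]. *)
have le_yx : y / x - 1 <= b - a.
  have -> : b - a = (y / x - 1) * (rate / y) * (2 * ln 2).
    by rewrite /a /b; field; rewrite !gt_eqF.
  have h1 : 1 <= rate / y by rewrite ler_pdivlMr// mul1r.
  have h2 : 1 <= 2 * ln 2 :> R by have := ln2_ge_half R; lra.
  have h0 : 0 <= y / x - 1 by rewrite subr_ge0 ler_pdivlMr// mul1r ltW.
  by rewrite -mulrA ler_peMr// mulr_ege1.
have neq0 : b - a != 0.
  rewrite gt_eqF//; apply: lt_le_trans le_yx.
  by rewrite subr_gt0 ltr_pdivlMr// mul1r.
(* What remains is [y / x < e^(b - a)], which follows from [1 + t < e^t] at the nonzero
   [t = b - a]. *)
rewrite -ltr_pdivrMl// mulrC; apply: le_lt_trans (expR_gt1Dx neq0).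
by rewrite -lerBlDl.
Qed.

Lemma nyquist_rate_ge {R : realType} {S : R -> R} {f : R} :
  S f != 0 -> ((2 * `|f|)%:E <= nyquist_rate S)%E.
Proof.
move=> Sf; rewrite EFinM lee_pmul2l//; apply: ereal_sup_ubound.
by exists f => //; exact: subset_closure.
Qed.

Section psd_theory.
Context {R : realType} {S : R -> R}.
Hypothesis S_ge0 : forall f, 0 <= S f.
Hypothesis S_int : lebesgue_measure.-integrable setT (EFin \o S).

Lemma integrable_shrink {k : R} : 0 <= k ->
  lebesgue_measure.-integrable setT (EFin \o (fun f => S f / (1 + k * S f))).
Proof.
(* The denominator is at least 1, so [S] dominates the quotient. *)
move=> k0; apply: (le_integrable measurableT _ _ S_int); last first.
  move=> x _ /=; rewrite lee_fin normrM ler_piMr// normfV.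
  by rewrite ger0_norm ?invf_le1 ?ler_wpDr ?ltr_wpDr ?addr_ge0 ?mulr_ge0.
have mS : measurable_fun setT S by apply/measurable_EFinP; exact: measurable_int S_int.
apply/measurable_EFinP; apply: measurable_funM => //.
(* The inverse is the power [-1] on nonnegative reals, so its measurability comes from that of
   [powR]. *)
rewrite (_ : (fun _ => _) = (fun y : R => y `^ (-1)) \o (fun x => 1 + k * S x)).
  apply: measurableT_comp; first exact: measurable_powR.
  by apply: measurable_funD => //; apply: measurable_funM.
by apply/funext => x /=; rewrite powR_inv1// addr_ge0 ?mulr_ge0.
Qed.

Lemma Rintegral_shrink_lt {k l : R} : 0 <= k -> k < l ->
  ~ {ae lebesgue_measure, forall f : R, S f = 0} ->
  \int[lebesgue_measure]_f (S f / (1 + l * S f)) <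
  \int[lebesgue_measure]_f (S f / (1 + k * S f)).
Proof.
move=> k0 kl Sneq0; rewrite ltNge; apply/negP => le_int; apply: Sneq0.
have l0 : 0 <= l by apply/ltW/(le_lt_trans k0).
have pos m x : 0 <= m -> 0 < 1 + m * S x.
  by move=> m0; rewrite ltr_wpDr ?mulr_ge0.
have := Rintegral_ge_ae_eq (integrable_shrink l0) (integrable_shrink k0) _ le_int.
have le_shrink x : S x / (1 + l * S x) <= S x / (1 + k * S x).
  by rewrite ler_wpM2l// lef_pV2 ?posrE ?pos// lerD2l ler_wpM2r// ltW.
move=> /(_ le_shrink); apply: filterS => x /eqP.
rewrite eqr_div ?(lt0r_neq0 (pos _ _ _))// => /eqP e.
(* Cross-multiplying the equal quotients leaves only this term, which forces [S x = 0] since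
   [k < l]. *)
have /eqP : (l - k) * (S x) ^+ 2 = 0.
  rewrite (_ : _ * _ = S x * (1 + l * S x) - S x * (1 + k * S x)); last by ring.
  by rewrite e subrr.
by rewrite mulf_eq0 subr_eq0 (gt_eqF kl) sqrf_eq0 => /eqP.
Qed.

Lemma mmse_star_eq0 {N fs : R} : 0 < N -> N <= fs ->
  (forall f, S f != 0 -> `[- (N / 2), N / 2]%classic f) -> mmse_star S fs = 0.
Proof.
move=> N0 Nfs suppS; apply/eqP; rewrite subr_eq0; apply/eqP.
set E := [set _ | _ in _].
have ubE : ubound E (variance_of_psd S).
  move=> _ [F [mF _] <-]; apply: fine_le.
  - by apply: integrable_fin_num => //; exact: integrableS S_int.
  - exact: integrable_fin_num.
  - by apply: ge0_subset_integral => //; [exact: measurable_int S_int|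
      move=> x _; rewrite lee_fin].
(* The interval carrying [S] has measure [N <= fs], so it competes in the supremum and attains the
   upper bound [variance_of_psd S]. *)
have Evar : E (variance_of_psd S).
  exists `[- (N / 2), N / 2]%classic; last exact: Rintegral_support.
  split => //; rewrite lebesgue_measure_itv/= lte_fin ifT; last lra.
  by rewrite -EFinB lee_fin; lra.
apply/eqP; rewrite eq_le ge_sup ?ub_le_sup//; last by exists (variance_of_psd S).
by exists (variance_of_psd S).
Qed.

Lemma D_PCM_support {N c0 fs rate : R} : 0 < N -> N <= fs ->
  (forall f, S f != 0 -> `[- (N / 2), N / 2]%classic f) ->
  D_PCM S c0 fs rate = \int[lebesgue_measure]_f
    (S f / (1 + fs * 2 `^ (2 * rate / fs) / c0 * S f)).
Proof.
move=> N0 Nfs suppS; rewrite /D_PCM (mmse_star_eq0 N0)// add0r.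
rewrite Rintegral_support; last first.
  move=> f; rewrite mulf_eq0 negb_or => /andP[/suppS + _].
  by rewrite /= !in_itv/= => /andP[? ?]; apply/andP; split; lra.
by congr (Rintegral _ _ _); apply/funext => f; rewrite mulrAC.
Qed.

End psd_theory.

Theorem corollary8 (R : realType) (d : measure_display)
    (Omega : measurableType d) (P : probability Omega R)
    (X : R -> {RV P >-> R}) (S : R -> R) (rate c0 fs_star : R)
    (hX : zero_mean_wss X)
    (hS : psd X S)
    (S_neq0 : ~ {ae lebesgue_measure, forall f : R, S f = 0})
    (S_unimodal : unimodal S)
    (S_bandlimited : (nyquist_rate S < +oo)%E)
    (rate_gt0 : 0 < rate) (c0_gt0 : 0 < c0)
    (fs_star_range : 0 < fs_star <= rate)
    (fs_star_min : forall fs : R, 0 < fs <= rate ->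
       D_PCM S c0 fs_star rate <= D_PCM S c0 fs rate) :
  (fs_star%:E <= nyquist_rate S)%E.
Proof.
have S_ge0 := psd_ge0 hS; have S_int := psd_integrable hS.
(* A nonzero frequency is required to make the Nyquist rate positive. It exists because a density
   living only on the null set [{0}] would vanish almost everywhere. *)
have [f0 [f0neq0 Sf0]] : exists f, f != 0 /\ S f != 0.
  apply: contrapT => nex; apply: S_neq0.
  exists [set 0]; split => //; first exact: lebesgue_measure_set1.
  move=> f /= Sf; apply: contrapT => /eqP fneq0; apply: nex; exists f.
  by split => //; apply/eqP.
rewrite leNgt; apply/negP => lt_fs.
have := fun f => @nyquist_rate_ge R S f.
move: lt_fs S_bandlimited; case: (nyquist_rate S) => [N| |] //; last first.
  (* The value [-oo] is excluded by the lower bound at [f0]. *)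
  by move=> _ _ /(_ _ Sf0).
rewrite lte_fin => Nfs _ S_le.
have N_gt0 : 0 < N.
  have := S_le _ Sf0; rewrite lee_fin; apply: lt_le_trans.
  by rewrite mulr_gt0// normr_gt0.
have suppS f : S f != 0 -> `[- (N / 2), N / 2]%classic f.
  by move=> /S_le; rewrite lee_fin /= in_itv/= -ler_norml => ?; lra.
have [_ fs_le] := andP fs_star_range.
have N_le : N <= rate by rewrite (le_trans (ltW Nfs)).
have := fs_star_min N; rewrite N_gt0 N_le => /(_ isT).
rewrite !(D_PCM_support S_ge0 S_int N_gt0)//; last exact: ltW.
apply/negP; rewrite -ltNge; apply: Rintegral_shrink_lt => //.
  by rewrite divr_ge0 ?mulr_ge0 ?powR_ge0 ?ltW// (lt_trans N_gt0).
by rewrite ltr_pM2r ?invr_gt0// mul_pow2_div_decreasing.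
Qed.
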